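(* Let $n$ be a positive odd integer. Among all rooted binary trees on $n$ vertices, the tree $T_{r,2}^n$ minimizes the number of root containing subtrees; that is, for every rooted binary tree $T$ on $n$ vertices with root $r$, $f_T(r)\geq f_{T_{r,2}^n}(r_0)$, where $r_0$ is the root of $T_{r,2}^n$.
   Context: A rooted binary tree is a rooted tree whose root has degree $2$ and in which every other vertex has degree $1$ or $3$; the single-vertex rooted tree is also allowed. Its number of vertices is always odd. The level of a vertex is its distance to the root. $T_{r,2}^n$ denotes the rooted binary tree on $n$ vertices with exactly two vertices at every (occurring) level except level zero, which contains only the root. A subtree of a tree $T$ is a (nonempty) connected subgraph of $T$, and $f_T(v)$ denotes the number of subtrees of $T$ containing the vertex $v$. *)

(* Defs.v *)
From mathcomp Require Import all_boot.
From mathcomp Require Import zify.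

Set Implicit Arguments.
Unset Strict Implicit.
Unset Printing Implicit Defensive.

(* A finite simple graph is given by its adjacency relation [e] on a finType. *)

Definition simple_graph (T : finType) (e : rel T) : Prop :=
  symmetric e /\ irreflexive e.

Definition connected_graph (T : finType) (e : rel T) : Prop :=
  0 < #|T| /\ forall x y : T, connect e x y.

(* A back-and-forth walk [:: x; y] along one edge is a [ucycle] of size 2, so  *)
(* genuine cycles are those of size at least 3.                               *)
Definition acyclic (T : finType) (e : rel T) : Prop :=
  forall c : seq T, ucycle e c -> size c < 3.

Definition is_tree (T : finType) (e : rel T) : Prop :=
  [/\ simple_graph e, connected_graph e & acyclic e].

Definition degree (T : finType) (e : rel T) (v : T) : nat :=
  #|[set w | e v w]|.

Definition rooted_binary_tree (T : finType) (e : rel T) (r : T) : Prop :=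
  is_tree e /\
  (#|T| = 1 \/
   degree e r = 2 /\
   forall v : T, v != r -> degree e v = 1 \/ degree e v = 3).

Definition walk_of_length (T : finType) (e : rel T) (x y : T) (k : nat) : bool :=
  [exists p : k.-tuple T, path e x p && (last x p == y)].

(* The least length of a walk from [x] to [y]; it is below #|T| when [y] is    *)
(* reachable from [x], and takes the junk value #|T| otherwise.               *)
Definition dist (T : finType) (e : rel T) (x y : T) : nat :=
  find (walk_of_length e x y) (iota 0 #|T|).

Definition level (T : finType) (e : rel T) (r v : T) : nat := dist e r v.

(* [is_Tr2 e r]: (T, e, r) is the tree T_{r,2}^n with n = #|T|, described by   *)
(* its defining property. Only [r] is at distance 0 from [r], so level zero   *)
(* needs no clause. [Tr2_exists] below shows such a tree exists for odd n.    *)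
Definition is_Tr2 (T : finType) (e : rel T) (r : T) : Prop :=
  rooted_binary_tree e r /\
  forall k : nat, 0 < k -> (exists v : T, level e r v = k) ->
    #|[set v | level e r v == k]| = 2.

Definition edges (T : finType) (e : rel T) : {set {set T}} :=
  [set [set p.1; p.2] | p : T * T & e p.1 p.2].

(* A subgraph is a pair (vertex set, edge set); it need not be induced.       *)
Definition is_subgraph (T : finType) (e : rel T)
    (H : {set T} * {set {set T}}) : bool :=
  (H.2 \subset edges e) && [forall E in H.2, E \subset H.1].

Definition sub_adj (T : finType) (H : {set T} * {set {set T}}) : rel T :=
  [rel x y | [set x; y] \in H.2].

Definition is_subtree (T : finType) (e : rel T)
    (H : {set T} * {set {set T}}) : bool :=
  [&& is_subgraph e H, H.1 != set0
    & [forall x in H.1, forall y in H.1, connect (sub_adj H) x y]].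

Definition num_subtrees (T : finType) (e : rel T) (v : T) : nat :=
  #|[set H : {set T} * {set {set T}} | is_subtree e H & v \in H.1]|.

(* A model of T_{r,2}^n for odd n: on {0, ..., n-1} with root 0, level         *)
(* k > 0 is {2k-1, 2k}, and both its vertices are children of 2(k-1)-1 (of 0   *)
(* when k = 1).                                                               *)

Definition Tr2_parent (j : nat) : nat := (uphalf j).*2 - 3.

Definition Tr2_adj (n : nat) : rel 'I_n :=
  [rel i j : 'I_n | (0 < j) && (Tr2_parent j == i) || (0 < i) && (Tr2_parent i == j)].

Lemma Tr2_adj_lt n (i j : 'I_n) : i < j -> Tr2_adj i j = (Tr2_parent j == i).
Proof.
rewrite /Tr2_adj /= /Tr2_parent => ij.
by apply/idP/idP; lia.
Qed.

Lemma Tr2_adj_sym n : symmetric (@Tr2_adj n).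
Proof. by move=> i j; rewrite /Tr2_adj /= orbC. Qed.

Lemma Tr2_adj_irr n : irreflexive (@Tr2_adj n).
Proof. by move=> i; rewrite /Tr2_adj /Tr2_parent /=; lia. Qed.

Lemma Tr2_walk m (j : 'I_m.*2.+1) : walk_of_length (@Tr2_adj _) ord0 j (uphalf j).
Proof.
move: {2}(val j) (leqnn j) => k; elim: k j => [|k IH] j jk.
  have -> : j = ord0 by apply: val_inj => /=; lia.
  by apply/existsP; exists [tuple]; rewrite /= eqxx.
have [j0|j0] := posnP j; first by apply: IH; rewrite j0.
have ltp : Tr2_parent j < m.*2.+1 by rewrite /Tr2_parent; have := ltn_ord j; lia.
pose i := Ordinal ltp.
have /existsP[p /andP[pp /eqP lp]] : walk_of_length (@Tr2_adj _) ord0 i (uphalf i).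
  by apply: IH; rewrite /= /Tr2_parent; lia.
have sz : size (rcons p j) == uphalf j.
  by rewrite size_rcons size_tuple /= /Tr2_parent; lia.
apply/existsP; exists (Tuple sz); rewrite /= rcons_path pp lp last_rcons eqxx.
by rewrite /Tr2_adj /= j0 eqxx.
Qed.

Lemma Tr2_walk_ge n (i : 'I_n) (p : seq 'I_n) :
  path (@Tr2_adj n) i p -> uphalf (last i p) <= uphalf i + size p.
Proof.
elim: p i => [|j p IH] i /=; first by rewrite addn0.
case/andP=> ij /IH; move: ij; rewrite /Tr2_adj /Tr2_parent /=.
set a := nat_of_ord (last j p); lia.
Qed.

Lemma Tr2_level m (j : 'I_m.*2.+1) : level (@Tr2_adj _) ord0 j = uphalf j.
Proof.
rewrite /level /dist card_ord.
have lt : uphalf j < m.*2.+1 by have := ltn_ord j; lia.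
have Hs : has (walk_of_length (@Tr2_adj _) ord0 j) (iota 0 m.*2.+1).
  by apply/hasP; exists (uphalf j); [rewrite mem_iota | exact: Tr2_walk].
apply/eqP; rewrite eqn_leq; apply/andP; split.
  rewrite leqNgt; apply/negP => /(before_find 0).
  by rewrite nth_iota // add0n Tr2_walk.
have := nth_find 0 Hs; move: Hs; rewrite has_find size_iota => Hs.
rewrite nth_iota // add0n => /existsP[p /andP[pp /eqP lp]].
by have := Tr2_walk_ge pp; rewrite lp size_tuple.
Qed.

Lemma Tr2_tree m : is_tree (@Tr2_adj m.*2.+1).
Proof.
split; first by split; [exact: Tr2_adj_sym | exact: Tr2_adj_irr].
  have c0 x : connect (@Tr2_adj m.*2.+1) ord0 x.
    have /existsP[p /andP[pp /eqP lp]] := Tr2_walk x.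
    by apply/connectP; exists p.
  split=> [|x y]; first by rewrite card_ord.
  by apply: connect_trans (c0 y); rewrite (sym_connect_sym (@Tr2_adj_sym _)).
move=> c; rewrite ltnNge => /andP[cc uc]; apply/negP => c3.
case: c c3 cc uc => // x0 c1 c3 cc uc.
set c := x0 :: c1 in c3 cc uc.
have [x xc xmax] : exists2 x, x \in c & forall y, y \in c -> y <= x.
  have x0c : x0 \in c by rewrite mem_head.
  by case: (@arg_maxnP _ x0 (mem c) (@nat_of_ord _) x0c) => x; exists x.
have [i s rs] := rot_to xc.
have ms y : y \in x :: s -> y <= x by rewrite -rs mem_rot; exact: xmax.
move: cc uc c3; rewrite -(rot_cycle i) -(rot_uniq i) -(size_rot i) rs.
case: s {rs} ms => [|a [|b s]] // ms /= /and3P[xa ab].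
rewrite rcons_path => /andP[_ lx] /andP[xs /andP[ua _]] _.
set z := last b s in lx.
have zs : z \in b :: s by exact: mem_last.
have lt y : y \in a :: b :: s -> y < x.
  move=> ys; rewrite ltn_neqAle ms ?inE; last first.
    by move: ys; rewrite !inE => ->; rewrite orbT.
  by rewrite andbT; apply: contraNneq xs => /val_inj <-.
move: xa lx; rewrite Tr2_adj_sym !Tr2_adj_lt ?lt ?mem_head //; last first.
  by rewrite in_cons zs orbT.
move=> /eqP pa /eqP pz.
have az : a = z by apply: val_inj; rewrite /= -pa -pz.
by rewrite az zs in ua.
Qed.

Lemma card_ord2 n (A : {set 'I_n}) (a b : nat) (s : a < b) (lb : b < n) :
  (forall x : 'I_n, (x \in A) = (x == a :> nat) || (x == b :> nat)) -> #|A| = 2.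
Proof.
move=> HA; have la : a < n by lia.
have -> : A = [set Ordinal la; Ordinal lb].
  by apply/setP=> x; rewrite HA !inE -!val_eqE.
by rewrite cards2 -val_eqE /=; lia.
Qed.

Lemma Tr2_exists (n : nat) :
  odd n -> exists (e : rel 'I_n) (r : 'I_n), is_Tr2 e r.
Proof.
move=> on; have -> : n = n./2.*2.+1 by lia.
move: n./2 => m {n on}; exists (@Tr2_adj _), ord0; split; last first.
  move=> k k0 [v]; rewrite Tr2_level => vk; have := ltn_ord v => vm.
  apply: (@card_ord2 _ _ k.*2.-1 k.*2); try lia.
  by move=> x; rewrite inE Tr2_level; lia.
split; first exact: Tr2_tree.
case: m => [|m]; [left | right]; first by rewrite card_ord.
split.
  apply: (@card_ord2 _ _ 1 2) => // x.
  by rewrite inE /Tr2_adj /Tr2_parent /=; lia.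
move=> v; rewrite -val_eqE /= => v0; have lv := ltn_ord v.
have ltp : Tr2_parent v < m.+1.*2.+1 by rewrite /Tr2_parent; lia.
have [ov|ev] := boolP (odd v && (v.+2 < m.+1.*2.+1)); [right | left].
  rewrite /degree (cardsD1 (Ordinal ltp)) inE {1}/Tr2_adj /= eqxx.
  have -> : 0 < v by lia.
  rewrite orbT; congr S.
  apply: (@card_ord2 _ _ v.+2 v.+3); try lia.
  by move=> x; rewrite !inE -val_eqE /Tr2_adj /Tr2_parent /=; lia.
rewrite /degree -(cards1 (Ordinal ltp)); apply: eq_card => x.
rewrite !inE -val_eqE /Tr2_adj /Tr2_parent /=; have := ltn_ord x; lia.
Qed.

(* Main.v *)
(* A subtree containing the root is determined by its vertex set, which can be *)
(* any set containing the root and closed under taking parents. Counting such  *)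
(* sets, the number F(v) of subtrees with top vertex v of the branch at v is 1 *)
(* at a leaf and (F(a) + 1) (F(b) + 1) at a vertex with children a and b. By   *)
(* induction F(v) >= 3 * 2^m - 2 when the branch has 2m + 1 vertices, with     *)
(* equality when no two siblings are both internal, as is the case in T_{r,2}: *)
(* otherwise the level below them would have four vertices.                    *)

Require Import Defs.
From mathcomp Require Import all_boot.
From mathcomp Require Import zify.

Set Implicit Arguments.
Unset Strict Implicit.
Unset Printing Implicit Defensive.

(** Both trees are studied through the parent map. By acyclicity a vertex has at most one neighbour
    that is not farther from the root than itself ([lower_neighbour_unique]), so the edges are
    exactly the child-parent pairs ([edge_parent]), and [num_subtreesE] replaces root containing
    subtrees by parent-closed vertex sets. [node_count] is the product recursion for such sets, and
    [rooted_sets_bound] runs the induction. Its inequality is applied to the arbitrary tree and its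
    equality case to T_{r,2}; the common order n gives the same m for both. *)

(** * Distances as lengths of shortest walks *)

Section Distance.

Variables (T : finType) (e : rel T).

(** The search in [dist] only tries lengths below [#|T|]; a connecting path can be shortened to a
    duplicate-free one, which is that short, so the junk value does not occur. *)
Lemma walk_dist x y : connect e x y -> walk_of_length e x y (dist e x y).
Proof.
case/connectP=> p0 /shortenP[p pp up _] ->.
have sp : size p < #|T|.
  by have := uniq_leq_size up (fun z _ => mem_enum T z); rewrite -cardE.
have Hs : has (walk_of_length e x (last x p)) (iota 0 #|T|).
  apply/hasP; exists (size p); first by rewrite mem_iota.
  by apply/existsP; exists (in_tuple p); rewrite /= pp eqxx.
have := nth_find 0 Hs; move: Hs; rewrite has_find size_iota => Hs.
by rewrite nth_iota.
Qed.

Lemma dist_path x p : path e x p -> dist e x (last x p) <= size p.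
Proof.
(* Since [dist] is at most [#|T|], a length below [dist] would be a valid index in the searched
   list, which [nth_iota] requires. *)
move=> pp; have := find_size (walk_of_length e x (last x p)) (iota 0 #|T|).
rewrite -/(dist e x (last x p)) size_iota => le.
rewrite leqNgt; apply/negP => lt.
have := before_find 0 lt; rewrite nth_iota ?add0n; last exact: leq_trans le.
suff -> : walk_of_length e x (last x p) (size p) by [].
by apply/existsP; exists (in_tuple p); rewrite /= pp eqxx.
Qed.

Lemma connect_dist x y : connect e x y ->
  exists2 p, path e x p & last x p = y /\ size p = dist e x y.
Proof.
case/walk_dist/existsP=> p /andP[pp /eqP lp]; exists p => //.
by rewrite size_tuple.
Qed.

Lemma dist_refl x : dist e x x = 0.
Proof. by have := @dist_path x [::] isT; rewrite leqn0 => /eqP. Qed.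

Lemma dist_edge x y z : connect e x y -> e y z -> dist e x z <= (dist e x y).+1.
Proof.
case/connect_dist=> p pp [lp <-] yz.
by have := @dist_path x (rcons p z); rewrite rcons_path pp lp last_rcons size_rcons; apply.
Qed.

Lemma dist_pred x y : connect e x y -> y != x ->
  exists2 z, e z y & dist e x z < dist e x y.
Proof.
case/connect_dist=> p; case/lastP: p => [|p w]; first by move=> _ [<-]; rewrite eqxx.
rewrite rcons_path last_rcons size_rcons => /andP[pp lw] [<- <-] _.
by exists (last x p); rewrite // ltnS dist_path.
Qed.

End Distance.

(** * Orienting a tree towards its root *)

Section TreeLevels.

Variables (T : finType) (e : rel T) (r : T).
Hypothesis tree_e : is_tree e.

Let lev := level e r.
Let e_sym : symmetric e. Proof. by case: tree_e => [[]]. Qed.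
Let conn x y : connect e x y. Proof. by case: tree_e => _ []. Qed.

(* From two such neighbours one descends to the root avoiding [x]; joining the *)
(* two descents and closing up through [x] would give a cycle.                *)
Lemma lower_neighbour_unique x y z :
  e x y -> e x z -> lev y <= lev x -> lev z <= lev x -> y = z.
Proof.
move=> xy xz ly lz; case: (tree_e) => [[_ irr] _ acyc].
have neq u v : e u v -> v != u by apply: contraTneq => ->; rewrite irr.
pose e' := [rel u v | [&& e u v, u != x & v != x]].
have down n u : lev u <= n -> u != x -> lev u <= lev x -> connect e' u r.
  elim: n u => [|n IH] u ln ux lx; (have [-> //|ur] := eqVneq u r);
    have [v vu lt] := dist_pred (conn r u) ur; have {}lt : lev v < lev u := lt.
    by move: ln lt; case: (lev u).
  have vx : v != x by apply: contraTneq lx => <-; rewrite -ltnNge.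
  apply: (@connect_trans _ _ v); last by apply: IH => //; lia.
  by apply: connect1; rewrite /= e_sym vu ux.
have sym' : symmetric e' by move=> u v; rewrite /= e_sym [(u != x) && _]andbC.
have : connect e' y z.
  apply: (@connect_trans _ _ r); first exact: (down (lev y)) (neq _ _ xy) ly.
  by rewrite (sym_connect_sym sym'); apply: (down (lev z)) (neq _ _ xz) lz.
case/connectP=> p0 /shortenP[p pp up _] lp {p0}.
(* An empty path means y = z; otherwise x, y and w already make the closed walk long enough to
   contradict acyclicity. *)
case: p pp up lp => [|w p] pp up lp; first by rewrite lp.
have xp : x \notin y :: w :: p.
  rewrite inE negb_or eq_sym neq //=.
  elim: (w :: p) {1}y pp => [//|u q IH] t /= /andP[/and3P[_ _ ux] /IH].
  by rewrite inE negb_or eq_sym ux.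
have pe : path e y (w :: p) by apply: sub_path pp => u v /and3P[].
suff /acyc : ucycle e [:: x, y, w & p] by [].
rewrite /ucycle cons_uniq xp up andbT /cycle rcons_path.
by move: pe => /= /andP[-> ->]; rewrite xy e_sym lp in xz *; rewrite xz.
Qed.

(** The default makes the root a fixed point, so ancestors are the iterates of a total function. *)
Definition parent x := odflt x [pick y | e x y && (lev y < lev x)].

Lemma lev_root : lev r = 0. Proof. exact: dist_refl. Qed.

Lemma parent_root : parent r = r.
Proof. by rewrite /parent; case: pickP => //= y; rewrite lev_root ltn0 andbF. Qed.

Lemma parentP x : x != r -> e x (parent x) /\ lev x = (lev (parent x)).+1.
Proof.
move=> xr; rewrite /parent; case: pickP => [y /andP[xy lt]|none] /=.
  split=> //; apply/eqP; rewrite eqn_leq lt andbT.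
  by apply: dist_edge; rewrite // e_sym.
have [z zx lt] := dist_pred (conn r x) xr.
by have := none z; rewrite e_sym zx lt.
Qed.

(** The endpoint of larger or equal level has a unique neighbour not above it, and its parent is
    such a neighbour. This also rules out edges inside a level. *)
Lemma edge_parent x y :
  e x y = (x != r) && (parent x == y) || (y != r) && (parent y == x).
Proof.
have half u v : e u v -> lev v <= lev u -> (u != r) && (parent u == v).
  move=> uv le.
  (* If u were the root, v would have level 0 and be the root too, giving a loop. *)
  have ur : u != r.
    apply: contraTneq uv => ur; move: le; rewrite ur lev_root leqn0.
    have [-> _|vr] := eqVneq v r; first by case: tree_e => [[_ ->]].
    by case: (parentP vr) => _ ->.
  case: (parentP ur) => up lu; rewrite ur; apply/eqP.
  by apply: lower_neighbour_unique up uv _ le; rewrite /= lu leqnSn.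
apply/idP/idP=> [xy|].
  case: (leqP (lev y) (lev x)) => [/(half _ _ xy) -> //|/ltnW le].
  by rewrite orbC half // e_sym.
by case/orP=> /andP[/parentP[ep _] /eqP <-] //; rewrite e_sym.
Qed.

End TreeLevels.

(** * Counting parent-closed sets, given only a parent map and levels *)

Section ParentStructure.

Variables (T : finType) (par : T -> T) (lev : T -> nat) (r : T).
Hypothesis par_root : par r = r.
Hypothesis lev_par : forall x, x != r -> lev x = (lev (par x)).+1.

Definition desc v := [set x | fconnect par x v].

Definition children v := [set w | (w != r) && (par w == v)].

(** These are the vertex sets of the subtrees with top vertex [v]: inside a branch, containing [v]
    and being closed under parents below [v] amounts to connectedness. *)
Definition rooted_sets v :=
  [set S : {set T} | [&& S \subset desc v, v \in S
     & [forall x in S, (x != v) ==> (par x \in S)]]].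

Lemma rooted_setsP v (S : {set T}) : reflect
  [/\ S \subset desc v, v \in S & forall x, x \in S -> x != v -> par x \in S]
  (S \in rooted_sets v).
Proof.
rewrite inE; apply: (iffP and3P) => [[sS vS /forall_inP cS]|[sS vS cS]]; split=> //.
  by move=> x xS xv; have /implyP-> := cS x xS.
by apply/forall_inP=> x xS; apply/implyP; apply: cS.
Qed.

Lemma desc_rec v x : (x \in desc v) = (x == v) || (par x \in desc v).
Proof. by rewrite !inE fconnect_eqVf. Qed.

Lemma desc_refl v : v \in desc v.
Proof. by rewrite desc_rec eqxx. Qed.

Lemma lev_par_le x : lev (par x) <= lev x.
Proof. by have [->|/lev_par->] := eqVneq x r; rewrite ?par_root. Qed.

Lemma lev_desc v x : x \in desc v -> lev v <= lev x.
Proof.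
rewrite inE => /connectP[p]; elim: p x => [|y p IH] x /=; first by move=> _ ->.
by case/andP=> /eqP <- pp /(IH _ pp) /leq_trans; apply; exact: lev_par_le.
Qed.

(** The root is fixed by [par], so climbing from it reaches nothing else. *)
Lemma desc_neq_root v x : x \in desc v -> x != v -> x != r.
Proof.
move=> xv; apply: contraNneq => xr; rewrite {}xr in xv *.
by move: xv; rewrite inE => /iter_findex <-; rewrite iter_fix.
Qed.

Lemma desc_root : desc r = [set: T].
Proof.
apply/setP=> x; rewrite in_setT; move: {2}(lev x) (leqnn (lev x)) => n.
elim: n x => [|n IH] x; have [->|xr] := eqVneq x r; rewrite ?desc_refl //.
  by rewrite lev_par.
by rewrite desc_rec lev_par // ltnS => /IH ->; rewrite orbT.
Qed.

Lemma child_desc v w : w \in children v -> desc w \subset desc v.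
Proof.
rewrite inE => /andP[_ /eqP <-]; apply/subsetP=> x; rewrite !inE => xw.
exact: connect_trans xw (fconnect1 _ _).
Qed.

Lemma child_neq v w x : w \in children v -> x \in desc w -> x != v.
Proof.
rewrite inE => /andP[wr /eqP <-] /lev_desc; rewrite lev_par //.
by apply: contraTneq => ->; rewrite ltnn.
Qed.

Lemma desc_children v x : x \in desc v -> x != v ->
  exists2 w, w \in children v & x \in desc w.
Proof.
move: {2}(lev x) (leqnn (lev x)) => n.
elim: n x => [|n IH] x le xv nv; have xr := desc_neq_root xv nv;
  rewrite lev_par // in le.
move: xv; rewrite desc_rec (negPf nv) /= => pv.
have [pe|pn] := eqVneq (par x) v; first by exists x; rewrite ?desc_refl // inE xr pe eqxx.
by have [w wv pw] := IH _ le pv pn; exists w; rewrite // desc_rec pw orbT.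
Qed.

(** Climb from [x] while it differs from both children. If it arrives at [a] and [a] differs from
    [b], then the parent [v] of [a] would lie below its own child [b]. *)
Lemma children_disjoint v a b x : a \in children v -> b \in children v ->
  x \in desc a -> x \in desc b -> a = b.
Proof.
move: {2}(lev x) (leqnn (lev x)) => n.
elim: n x a b => [|n IH] x a b le av bv.
  move=> /lev_desc; move: av; rewrite inE => /andP[/lev_par-> _]; lia.
move=> xa xb; have [xea|xna] := eqVneq x a.
  apply/eqP; apply: contraTT xb => anb; rewrite xea desc_rec (negPf anb) /=.
  move: (av); rewrite inE => /andP[_ /eqP->].
  by apply/negP=> /(child_neq bv); rewrite eqxx.
have [xeb|xnb] := eqVneq x b.
  apply/eqP; apply: contraTT xa; rewrite eq_sym => anb; rewrite xeb desc_rec (negPf anb) /=.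
  move: (bv); rewrite inE => /andP[_ /eqP->].
  by apply/negP=> /(child_neq av); rewrite eqxx.
have xr := desc_neq_root xa xna.
move: xa xb; rewrite !(desc_rec _ x) (negPf xna) (negPf xnb) /=.
by apply: IH => //; rewrite lev_par in le.
Qed.

Lemma leaf_desc v : children v = set0 -> desc v = [set v].
Proof.
move=> c0; apply/setP=> x; rewrite in_set1.
apply/idP/eqP=> [xv|->]; last exact: desc_refl.
apply/eqP; apply: contraT => /(desc_children xv)[w]; by rewrite c0 inE.
Qed.

Lemma leaf_count v : children v = set0 -> #|rooted_sets v| = 1.
Proof.
move=> /leaf_desc dv; rewrite -(cards1 [set v]); apply: eq_card => S.
rewrite inE; apply/rooted_setsP/eqP => [[]|->]; rewrite dv.
  move=> sS vS _; apply/eqP; by rewrite eqEsubset sS sub1set.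
by rewrite subxx in_set1 eqxx; split=> // x /set1P ->; rewrite eqxx.
Qed.

Section TwoChildren.

Variables (v a b : T).
Hypotheses (ab : a != b) (chv : children v = [set a; b]).

Let av : a \in children v. Proof. by rewrite chv set21. Qed.
Let bv : b \in children v. Proof. by rewrite chv set22. Qed.
Let par_a : par a = v. Proof. by move: av; rewrite inE => /andP[_ /eqP]. Qed.
Let par_b : par b = v. Proof. by move: bv; rewrite inE => /andP[_ /eqP]. Qed.
Let disj x : x \in desc a -> x \in desc b -> False.
Proof. by move=> xa xb; case/eqP: ab; exact: children_disjoint av bv xa xb. Qed.

Lemma node_desc : desc v = v |: (desc a :|: desc b).
Proof.
apply/setP=> x; rewrite !in_setU in_set1.
apply/idP/idP=> [xv|/or3P[/eqP->|xa|xb]].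
- have [//|/(desc_children xv)[w]] := eqVneq x v.
  by rewrite chv => /set2P[] -> ->; rewrite ?orbT.
- exact: desc_refl.
- exact: (subsetP (child_desc av)).
- exact: (subsetP (child_desc bv)).
Qed.

Lemma node_card : #|desc v| = (#|desc a| + #|desc b|).+1.
Proof.
rewrite node_desc cardsU1 !inE.
have -> : fconnect par v a = false.
  by apply/negP=> va; have := @child_neq v a v av; rewrite inE eqxx => /(_ va).
have -> : fconnect par v b = false.
  by apply/negP=> vb; have := @child_neq v b v bv; rewrite inE eqxx => /(_ vb).
rewrite cardsU; suff -> : desc a :&: desc b = set0 by rewrite cards0 subn0.
by apply/setP=> x; rewrite in_setI in_set0; apply/negP=> /andP[] /disj.
Qed.

(** The possible traces of a subtree on the branch at a child: it may miss the branch altogether,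
    whence the +1 in each factor of the recursion. *)
Let opt w := set0 |: rooted_sets w.

Let card_opt w : #|opt w| = #|rooted_sets w|.+1.
Proof.
rewrite cardsU1; suff -> : set0 \notin rooted_sets w by [].
by apply/negP=> /rooted_setsP[_]; rewrite inE.
Qed.

Let opt_sub w A : A \in opt w -> A \subset desc w.
Proof. by case/setU1P=> [->|/rooted_setsP[]]; rewrite ?sub0set. Qed.

Let opt_par w A x : A \in opt w -> x \in A -> x = w \/ par x \in A.
Proof.
case/setU1P=> [->|/rooted_setsP[_ _ cA] xA]; first by rewrite inE.
by have [->|/(cA _ xA)] := eqVneq x w; [left|right].
Qed.

(** A nonempty trace is closed under parents up to [w], so climbing from any of its elements shows
    that it contains [w]. *)
Let trace_opt w S : w \in children v -> S \in rooted_sets v -> S :&: desc w \in opt w.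
Proof.
move=> wv /rooted_setsP[_ _ cS]; apply/setU1P.
have cw x : x \in S :&: desc w -> x != w -> par x \in S :&: desc w.
  case/setIP=> xS xw nw; rewrite in_setI cS //=; last exact: child_neq wv xw.
  by move: xw; rewrite desc_rec (negPf nw).
have [->|/set0Pn[x xI]] := eqVneq (S :&: desc w) set0; [by left|right].
apply/rooted_setsP; split=> //; first exact: subsetIr.
have: x \in desc w by case/setIP: xI.
rewrite inE => /connectP[p]; elim: p x xI => [|y p IH] x xI /=; first by move=> _ wx; rewrite {1}wx.
case/andP=> /eqP <- pp lp; have [xw|nw] := eqVneq x w; first by rewrite -{1}xw.
exact: IH (cw _ xI nw) pp lp.
Qed.

Let glue (AB : {set T} * {set T}) := v |: (AB.1 :|: AB.2).

Let glue_inj : {in setX (opt a) (opt b) &, injective glue}.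
Proof.
have trace A B : A \in opt a -> B \in opt b ->
    glue (A, B) :&: desc a = A /\ glue (A, B) :&: desc b = B.
  move=> /opt_sub/subsetP sA /opt_sub/subsetP sB.
  split; apply/setP=> x; rewrite in_setI in_setU1 in_setU /=.
    apply/idP/idP=> [/andP[/or3P[/eqP->||/sB xb]] xa //|xA]; last by rewrite xA sA ?orbT.
      by have := child_neq av xa; rewrite eqxx.
    by case: (disj xa xb).
  apply/idP/idP=> [/andP[/or3P[/eqP->|/sA xa|]] xb //|xB]; last by rewrite xB sB ?orbT.
    by have := child_neq bv xb; rewrite eqxx.
  by case: (disj xa xb).
move=> [A B] [A' B'] /setXP[/= Aa Bb] /setXP[/= Aa' Bb'] eqg.
have [eA eB] := trace _ _ Aa Bb; have [eA' eB'] := trace _ _ Aa' Bb'.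
by congr (_, _); [rewrite -eA eqg | rewrite -eB eqg].
Qed.

(** The traces on the two branches can be chosen independently, and [glue] recovers the set from
    them by adding [v]. *)
Lemma node_count :
  #|rooted_sets v| = (#|rooted_sets a|).+1 * (#|rooted_sets b|).+1.
Proof.
rewrite -!card_opt -cardsX -(card_in_imset glue_inj); apply: eq_card => S.
apply/idP/imsetP=> [Sv|[[A B] /setXP[/= Aa Bb] ->]].
  exists (S :&: desc a, S :&: desc b); first by apply/setXP; rewrite !trace_opt.
  case/rooted_setsP: Sv => sS vS _.
  rewrite /glue /= -setIUr; apply/setP=> x; rewrite in_setU1 in_setI.
  have [-> //|nv] := eqVneq x v.
  have [/(subsetP sS)|//] := boolP (x \in S).
  by rewrite node_desc in_setU1 (negPf nv) => ->.
apply/rooted_setsP; split.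
- by rewrite node_desc setUS // setUSS // opt_sub.
- exact: setU11.
move=> x; rewrite !in_setU !in_set1 /= => /orP[->//|/orP[xA|xB]] _.
  by case: (opt_par Aa xA) => [->|->]; rewrite ?par_a ?eqxx ?orbT.
by case: (opt_par Bb xB) => [->|->]; rewrite ?par_b ?eqxx ?orbT.
Qed.

End TwoChildren.

(* [3 * 2 ^ m - 2] is the number of root containing subtrees of T_{r,2}^(2m+1).  *)
(* With [x = 2 ^ i] and [y = 2 ^ j], the induction step amounts to               *)
(* [(3 x - 1) (3 y - 1) + 2 - 6 x y = 3 (x - 1) (y - 1) >= 0].                    *)
Lemma rooted_sets_bound v :
  (forall u, children u = set0 \/ #|children u| = 2) ->
  exists m, [/\ #|desc v| = m.*2.+1, 3 * 2 ^ m <= #|rooted_sets v| + 2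
    & (forall u a b, a != b -> children u = [set a; b] ->
         children a = set0 \/ children b = set0) ->
      #|rooted_sets v| + 2 = 3 * 2 ^ m].
Proof.
move=> bin; move: {2}#|desc v| (leqnn #|desc v|) => n.
have leaf u : children u = set0 -> #|desc u| = 1 /\ #|rooted_sets u| = 1.
  by move=> u0; rewrite leaf_desc // leaf_count // cards1.
elim: n v => [|n IH] v.
  by rewrite leqn0 cards_eq0 => /eqP d0; have := desc_refl v; rewrite d0 inE.
have [/leaf[-> ->] _|/eqP/cards2P[a [b [ab chv]]]] := bin v; first by exists 0.
rewrite (node_card ab chv) (node_count ab chv) ltnS => le.
have [i [di fi ei]] := IH a (leq_trans (leq_addr _ _) le).
have [j [dj fj ej]] := IH b (leq_trans (leq_addl _ _) le).
exists (i + j).+1; rewrite di dj expnS expnD; split; first by lia.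
  (* From here [x] and [y] stand for 2^i - 1 and 2^j - 1, which avoids truncated subtraction; the
     factor 3x + 2 below is 3 * 2^i - 1. *)
  case: (2 ^ i) (expn_gt0 2 i) fi => // x _ fi; case: (2 ^ j) (expn_gt0 2 j) fj => // y _ fj.
  have le_ab : (3 * x + 2) * (3 * y + 2) <=
    #|rooted_sets a|.+1 * #|rooted_sets b|.+1 by apply: leq_mul; lia.
  by apply: leq_trans (leq_add le_ab (leqnn 2)); nia.
move=> cat; have := ei cat; have := ej cat => {}ej {}ei.
(* Beside a leaf the recursion loses nothing: 2 (3 * 2^j - 1) + 2 = 3 * 2^(j+1). *)
case: (cat _ _ _ ab chv) => /leaf[dk fk].
  have i0 : i = 0 by lia.
  by rewrite fk i0 expn0 mul1n; lia.
have j0 : j = 0 by lia.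
by rewrite fk j0 expn0 muln1; lia.
Qed.

End ParentStructure.

(** * Root containing subtrees as parent-closed sets *)

Section Subtrees.

Variables (T : finType) (e : rel T) (r : T).
Hypothesis tree_e : is_tree e.

Let par := parent e r.
Let lev := level e r.
Let e_sym : symmetric e. Proof. by case: tree_e => [[]]. Qed.
Let par_root : par r = r := parent_root e r.
Let lev_par x : x != r -> lev x = (lev (par x)).+1.
Proof. by case/(parentP tree_e). Qed.
Let edgeE x y : e x y = (x != r) && (par x == y) || (y != r) && (par y == x).
Proof. exact: edge_parent. Qed.
Let edge_par x : x != r -> e x (par x).
Proof. by case/(parentP tree_e). Qed.

(** For a parent-closed [S] containing the root, this is the only edge set that makes [S] a
    subtree. *)
Definition span (S : {set T}) : {set {set T}} :=
  [set [set x; par x] | x in S :\ r].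

Let edgesP (E : {set T}) : E \in edges e ->
  exists x, x != r /\ E = [set x; par x].
Proof.
case/imsetP=> [[x y]]; rewrite inE /= edgeE => xy ->.
case/orP: xy => /andP[xr /eqP <-]; first by exists x.
by exists y; rewrite setUC.
Qed.

Let par_edges x : x != r -> [set x; par x] \in edges e.
Proof. by move=> xr; apply/imsetP; exists (x, par x); rewrite ?inE ?edge_par. Qed.

Let sub_adj_edge (H : {set T} * {set {set T}}) x y :
  H.2 \subset edges e -> sub_adj H x y -> e x y.
Proof.
move=> /subsetP sH /sH/imsetP[[u w]]; rewrite inE /= => uw eq.
have irr : irreflexive e by case: tree_e => [[]].
have: x \in [set u; w] by rewrite -eq set21.
have: y \in [set u; w] by rewrite -eq set22.
have: u \in [set x; y] by rewrite eq set21.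
have: w \in [set x; y] by rewrite eq set22.
rewrite !inE => h1 h2 h3 h4.
have nuw : u != w by apply: contraTneq uw => ->; rewrite irr.
case/orP: h4 => /eqP xE; case/orP: h3 => /eqP yE; subst x y => //.
- by move: h1; rewrite orbb eq_sym (negPf nuw).
- by rewrite e_sym.
- by move: h2; rewrite orbb (negPf nuw).
Qed.

(* A walk in [H] from [x] to the root can leave the descendants of [x] only  *)
(* through the edge from [x] to its parent.                                 *)
Let subtree_edge H x : is_subtree e H -> r \in H.1 -> x \in H.1 -> x != r ->
  [set x; par x] \in H.2.
Proof.
case/and3P=> /andP[sE _] _ /forall_inP cH rH xH xr.
have /connectP[p] := forall_inP (cH x xH) r rH.
have rNd : r \notin desc par x.
  by apply/negP=> /(desc_neq_root par_root); rewrite eqxx eq_sym xr => /(_ isT).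
have: x \in desc par x by exact: desc_refl.
elim: p {1 3 4}x => [|z p IH] y yx /=; first by move=> _ ry; rewrite ry yx in rNd.
case/andP=> yz pp lp; have [zx|zNx] := boolP (z \in desc par x); first exact: IH zx pp lp.
have := sub_adj_edge sE yz; rewrite edgeE => /orP[]/andP[_ /eqP pz].
  move: yx; rewrite desc_rec pz (negPf zNx) orbF => /eqP yx.
  by move: yz; rewrite /sub_adj /= yx -pz yx.
by move: zNx; rewrite desc_rec pz yx orbT.
Qed.

(** The bijection is S -> (S, [span S]). Connectedness forces every parent edge into a subtree
    ([subtree_edge]), which gives closure under parents, and every edge of the tree is a parent
    edge. Conversely, in a parent-closed set each vertex climbs to the root along [span S]. *)
Lemma num_subtreesE : num_subtrees e r = #|rooted_sets par r|.
Proof.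
have inj : injective (fun S => (S, span S)) by move=> S S' [].
rewrite -(card_imset _ inj); apply: eq_card => H; rewrite inE.
apply/andP/imsetP=> [[tH rH]|[S /rooted_setsP[_ rS cS] ->]].
  have par_edge := subtree_edge tH rH.
  case/and3P: (tH) => /andP[/subsetP sE /forall_inP inc] _ _.
  exists H.1.
    apply/rooted_setsP; split; rewrite ?(desc_root lev_par) ?subsetT // => x xH xr.
    by have /inc/subsetP := par_edge x xH xr; apply; rewrite set22.
  case: H tH rH par_edge sE inc => S E /= tH rH par_edge sE inc.
  congr (_, _); apply/setP=> F; apply/idP/imsetP=> [FE|[x /setD1P[xr xS] ->]].
    have [x [xr eF]] := edgesP (sE _ FE); exists x => //; rewrite in_setD1 xr.
    by have /subsetP := inc _ FE; apply; rewrite eF set21.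
  exact: par_edge.
split=> //=; apply/and3P; split=> /=.
- apply/andP; split=> /=.
    by apply/subsetP=> F /imsetP[x /setD1P[xr _] ->]; exact: par_edges.
  apply/forall_inP=> F /imsetP[x /setD1P[xr xS] ->].
  by rewrite subUset !sub1set xS cS.
- by apply/set0Pn; exists r.
have sym : connect_sym (sub_adj (S, span S)).
  by apply: sym_connect_sym => x y; rewrite /sub_adj /= setUC.
suff up x : x \in S -> connect (sub_adj (S, span S)) x r.
  apply/forall_inP=> x xS; apply/forall_inP=> y yS.
  by apply: connect_trans (up x xS) _; rewrite sym up.
move: {2}(lev x) (leqnn (lev x)) => n.
elim: n x => [|n IH] x le xS; (have [-> //|xr] := eqVneq x r);
  rewrite lev_par // in le.
apply: connect_trans (IH _ le (cS x xS xr)).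
by apply: connect1; apply/imsetP; exists x; rewrite // in_setD1 xr.
Qed.

Lemma degreeE v : degree e v = (v != r) + #|children par r v|.
Proof.
rewrite /degree; have [->|vr] := eqVneq v r.
  by apply: eq_card => w; rewrite !inE edgeE eqxx.
rewrite (cardsD1 (par v)) inE edge_par //; congr (_ + _).
apply: eq_card => w; rewrite !inE edgeE vr /= (eq_sym w).
(* The parent of [v] is not also a child of [v], by levels, so it is counted once. *)
have [pv|//] := eqVneq (par v) w; symmetry; apply/negbTE/negP => /andP[wr /eqP pw].
have := lev_par vr; rewrite pv (lev_par wr) pw; lia.
Qed.

End Subtrees.

(** * Comparison of the two trees *)

Lemma binary_children (T : finType) (e : rel T) (r : T) :
  rooted_binary_tree e r ->
  forall v, children (parent e r) r v = set0 \/ #|children (parent e r) r v| = 2.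
Proof.
move=> [te bin] v; case: bin => [T1|[dr dv]].
  left; apply/eqP; rewrite -subset0; apply/subsetP=> w; rewrite inE => /andP[wr _].
  by have /card_le1P := eq_leq T1; move/(_ w isT r); rewrite !inE eq_sym (negPf wr).
have [->|vr] := eqVneq v r; first by right; move: dr; rewrite (degreeE r te) eqxx.
case: (dv v vr); rewrite (degreeE r te) vr => -[]; last by right.
by move/cards0_eq; left.
Qed.

Theorem proposition2p13 (n : nat) (hn : odd n)
    (T0 : finType) (e0 : rel T0) (r0 : T0)
    (h0 : is_Tr2 e0 r0) (card0 : #|T0| = n)
    (T : finType) (e : rel T) (r : T)
    (hT : rooted_binary_tree e r) (cardT : #|T| = n) :
  num_subtrees e0 r0 <= num_subtrees e r.
Proof.
case: h0 => h0 lev2; have bin0 := binary_children h0; have bin := binary_children hT.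
case: h0 hT => t0 _ [t _]; rewrite !num_subtreesE //.
have lev_par x : x != r -> level e r x = (level e r (parent e r x)).+1.
  by case/(parentP t).
have lev_par0 x : x != r0 -> level e0 r0 x = (level e0 r0 (parent e0 r0 x)).+1.
  by case/(parentP t0).
have [m [dm fm _]] := rooted_sets_bound (parent_root e r) lev_par r bin.
have [m0 [dm0 _ fm0]] := rooted_sets_bound (parent_root e0 r0) lev_par0 r0 bin0.
move: dm dm0; rewrite !(desc_root lev_par, desc_root lev_par0) !cardsT card0 cardT.
move=> dm dm0; have mE : m0 = m by lia.
suff /fm0 : forall u a b : T0, a != b -> children (parent e0 r0) r0 u = [set a; b] ->
    children (parent e0 r0) r0 a = set0 \/ children (parent e0 r0) r0 b = set0.
  by rewrite mE; lia.
move=> u a b ab chu.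
have [|a2] := bin0 a; [by left|]; have [|b2] := bin0 b; [by right|].
have lev_gchild c w : c \in [set a; b] -> w \in children (parent e0 r0) r0 c ->
    level e0 r0 w = (level e0 r0 u).+2.
  rewrite -chu !inE => /andP[cr /eqP cu] /andP[wr /eqP wc].
  by rewrite lev_par0 // wc lev_par0 // cu.
(* The two-vertex condition concerns occurring levels only, so a grandchild of [u] is exhibited
   first; the four grandchildren then overfill its level. *)
have [w wa] : exists w, w \in children (parent e0 r0) r0 a.
  by apply/set0Pn; rewrite -card_gt0 a2.
have := lev2 _ (ltn0Sn _) (ex_intro _ w (lev_gchild a w (set21 _ _) wa)).
set L := [set _ | _] => cL.
have: children (parent e0 r0) r0 a :|: children (parent e0 r0) r0 b \subset L.
  by apply/subsetP=> x /setUP[] xc; rewrite inE (lev_gchild _ _ _ xc) // ?set21 ?set22.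
move/subset_leq_card; rewrite cL cardsU a2 b2.
suff -> : children (parent e0 r0) r0 a :&: children (parent e0 r0) r0 b = set0.
  by rewrite cards0.
apply/setP=> x; rewrite !inE; apply/negP=> /andP[/andP[_ /eqP pa] /andP[_ /eqP pb]].
by case/eqP: ab; rewrite -pa -pb.
Qed.
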